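(* Let $G$ be a connected graph of order $n\ge 4$ with diameter $d\ge 2$, remoteness $\rho$ and distance eigenvalues $\partial_1\ge \partial_2\ge\cdots\ge \partial_n$. Then $$\rho+\partial_{\left\lfloor \frac{7d}{8}\right\rfloor}>0.$$
   Context: All graphs are finite, simple and undirected. For a connected graph $G$ with vertex set $V(G)=\{v_1,\dots,v_n\}$, $d_G(u,v)$ is the length of a shortest path between $u$ and $v$, and the diameter $d$ is the maximum of $d_G(u,v)$ over all pairs of vertices. The transmission of $v\in V(G)$ is $Tr(v)=\sum_{u\in V(G)} d_G(u,v)$, and the remoteness of $G$ is $\rho=\max_{v\in V(G)} \frac{Tr(v)}{n-1}$. The distance matrix $D(G)$ is the $n\times n$ real symmetric matrix with $(i,j)$-entry $d_G(v_i,v_j)$; its eigenvalues, counted with multiplicity and listed in non-increasing order $\partial_1\ge\cdots\ge\partial_n$, are the distance eigenvalues of $G$. *)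

(* Defs.v *)
From mathcomp Require Import all_boot all_order all_algebra.
From mathcomp Require Import reals.

Set Implicit Arguments.
Unset Strict Implicit.
Unset Printing Implicit Defensive.

Import Order.TTheory GRing.Theory Num.Theory.

(* A finite simple graph is a symmetric irreflexive relation on a finType. *)
Definition simple_graph (T : finType) (e : rel T) : Prop :=
  symmetric e /\ irreflexive e.

Definition connected_graph (T : finType) (e : rel T) : Prop :=
  forall u v : T, connect e u v.

Definition has_path_of_length (T : finType) (e : rel T) (u v : T) : pred nat :=
  fun k => [exists p : k.-tuple T,
              [&& path e u p, last u p == v & uniq (u :: p)]].

(* The least length of a path from u to v. A path has length less than #|T|,
   so the search range is exhaustive; #|T| is the value of gdist exactly when
   u and v are not connected. *)
Definition gdist (T : finType) (e : rel T) (u v : T) : nat :=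
  find (has_path_of_length e u v) (iota 0 #|T|).

Definition diameter (T : finType) (e : rel T) : nat :=
  \max_(u : T) \max_(v : T) gdist e u v.

Definition transmission (T : finType) (e : rel T) (v : T) : nat :=
  \sum_(u : T) gdist e u v.

Local Open Scope ring_scope.

(* The terms are nonnegative, so the initial value 0 does not affect the max. *)
Definition remoteness (R : realType) (T : finType) (e : rel T) : R :=
  \big[Num.max/0]_(v : T) ((transmission e v)%:R / (#|T| - 1)%:R).

Definition distance_matrix (R : realType) (T : finType) (e : rel T) :
    'M[R]_#|T| :=
  \matrix_(i, j) (gdist e (enum_val i) (enum_val j))%:R.

(* ev lists the eigenvalues of A, with multiplicity, in non-increasing order;
   its items are numbered from 0. *)
Definition eigenvalues_of (R : realType) (n : nat) (A : 'M[R]_n)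
    (ev : n.-tuple R) : Prop :=
  sorted >=%R ev /\ char_poly A = \prod_(x <- ev) ('X - x%:P).

Definition distance_eigenvalues (R : realType) (T : finType) (e : rel T)
    (ev : #|T|.-tuple R) : Prop :=
  eigenvalues_of (distance_matrix R e) ev.

(* Main.v *)
Require Import Defs.
From mathcomp Require Import all_boot all_order all_algebra.
From mathcomp Require Import reals.
From mathcomp Require Import complex spectral ring lra zify.

Set Implicit Arguments.
Unset Strict Implicit.

Import Order.TTheory GRing.Theory Num.Theory.
Local Open Scope ring_scope.

(** Let [d] be the diameter. Both ends of a diametral pair of vertices have
    transmissions adding up to at least [d] times the order, so the remoteness
    exceeds [d / 2] ([remoteness_gt_half_diameter]), and it suffices to show
    that the eigenvalue of index [7 d / 8] (rounded down) is at least
    [- d / 2].  By the min-max principle ([eigenvalue_ge_of_form]) this follows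
    from a subspace of that dimension on which the distance form is at least
    [- d / 2] times the squared norm.

    Only vectors supported on a shortest path [p 0, ..., p d] between the ends
    of a diametral pair are used.  Such a path is isometric, so the form there
    is the sum of [|i - j| * y_i * y_j].  Write [W_t] for the sum of the [y_i]
    with [i < t] minus the sum of the others.  Counting the cuts that separate
    [i] from [j] turns the form into half of
    [d * W_0 ^ 2 - (W_1 ^ 2 + ... + W_d ^ 2)] ([path_form_cut_sum]), while
    [y_i] is half of [W_(i+1) - W_i] and [W_(d+1) = - W_0].  The required bound
    is thus a discrete Poincare inequality for the antiperiodic sequence [W].

    The subspace consists of the [y] for which [W] vanishes at at most
    [d + 1 - 7 d / 8] prescribed positions of [0, ..., d].  These cut the cycle
    into short blocks with zero boundary values, and on each block the Poincare
    inequality is witnessed by a positive supersolution, in the manner of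
    Barta's bound for Dirichlet eigenvalues ([path_form_ge]).  The
    supersolution vanishes exactly at the prescribed positions.  For most [d]
    it is a concatenation of equal parabolic arcs [x * (g - x)], and [g = 8]
    serves every [d >= 32].  The values 6, 7, 8, 15 and 16 are too tight for
    this.  There the positive term [d * W_0 ^ 2] allows the position [0] to lie
    inside a block instead of being a zero ([exists_weight]). *)

(** * A min-max bound for real symmetric matrices *)

Local Notation "M ^t*" := (map_mx Num.conj M^T) (at level 30).

Lemma complex_form_split (C : numClosedFieldType) (q : nat)
    (a b : 'rV[C]_q) (B : 'M[C]_q) (a' b' : 'cV[C]_q) :
    a *m B *m b' = b *m B *m a' ->
  (a + 'i *: b) *m B *m (a' - 'i *: b') = a *m B *m a' + b *m B *m b'.
Proof.
move=> symm; rewrite !mulmxDl !mulmxBr -!scalemxAr -!scalemxAl symm.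
by rewrite scalerA -expr2 sqrCi scaleN1r opprK addrA subrK.
Qed.

(** The imaginary cross terms cancel by symmetry, leaving the sum of the form at
    the real part and at the imaginary part. *)
Lemma complexified_form_ge0 (R : realType) (q : nat) (B : 'M[R]_q) :
    B^T = B ->
    (forall y : 'rV[R]_q, 0 <= (y *m B *m y^T) 0 0) ->
  forall z : 'rV[R[i]]_q,
    0 <= (z *m map_mx (real_complex R) B *m z^t*) 0 0.
Proof.
move=> symB posB z; set f := real_complex R.
pose a := map_mx (@complex.Re R) z; pose b := map_mx (@complex.Im R) z.
have conjf x : Num.conj (f x) = f x by apply/CrealP/complex_realP; exists x.
have zE : z = map_mx f a + 'i *: map_mx f b.
  by apply/rowP=> j; rewrite !mxE {1}[z 0 j]complexE complexiE.
have zsE : z^t* = map_mx f a^T - 'i *: map_mx f b^T.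
  apply/matrixP=> j k; rewrite zE !mxE rmorphD rmorphM /=.
  by rewrite !conjf conjCi mulNr.
have symm : a *m B *m b^T = b *m B *m a^T.
  have <- : (a *m B *m b^T)^T = b *m B *m a^T.
    by rewrite !trmx_mul !trmxK symB mulmxA.
  by apply/matrixP=> j k; rewrite [RHS]mxE (ord1 j) (ord1 k).
suff -> : z *m map_mx f B *m z^t* =
    map_mx f (a *m B *m a^T + b *m B *m b^T).
  by rewrite mxE -[0]/(f 0) lecR mxE addr_ge0.
have cross : map_mx f a *m map_mx f B *m map_mx f b^T
    = map_mx f b *m map_mx f B *m map_mx f a^T.
  by rewrite -!map_mxM symm.
by rewrite zsE {1}zE (complex_form_split cross) -!map_mxM -map_mxD.
Qed.

Lemma count_sorted_ge (R : realType) (s : seq R) (i : nat) (mu : R) :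
  sorted >=%R s -> (i < size s)%N -> s`_i < mu ->
  (count (>= mu) s <= i)%N.
Proof.
move=> srt lti ltmu.
rewrite -(cat_take_drop i s) count_cat.
suff /eqP-> : count (>= mu) (drop i s) == 0%N.
  by rewrite addn0 (leq_trans (count_size _ _)) // size_take lti.
rewrite -leqn0 leqNgt -has_count -all_predC.
apply/(all_nthP 0) => j; rewrite size_drop => ltj /=.
rewrite nth_drop -ltNge (le_lt_trans _ ltmu) //.
apply: (@sorted_leq_nth _ >=%R) => //; rewrite ?inE ?leq_addr //.
- by move=> x y z /[swap]; apply: le_trans.
- exact: lexx.
- by rewrite -ltn_subRL.
Qed.

Lemma char_poly_conj (F : comNzRingType) (n : nat) (P Q D : 'M[F]_n) :
  Q *m P = 1%:M -> char_poly (Q *m D *m P) = char_poly D.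
Proof.
move=> QP; rewrite /char_poly.
have -> : char_poly_mx (Q *m D *m P)
    = map_mx polyC Q *m char_poly_mx D *m map_mx polyC P.
  rewrite /char_poly_mx mulmxBr mulmxBl !map_mxM mul_mx_scalar -scalemxAl.
  by rewrite -(map_mxM _ Q P) QP map_mx1 scalemx1.
rewrite !det_mulmx mulrC mulrA -det_mulmx -map_mxM.
by rewrite (mulmx1C QP) map_mx1 det1 mul1r.
Qed.

(** The spectral theorem is applied over [R[i]], where every characteristic
    polynomial splits; unique factorization then identifies the diagonal with
    the given real eigenvalues, up to order. *)
Lemma spectral_decomposition (R : realType) (n : nat) (A : 'M[R]_n)
    (ev : n.-tuple R) :
    A^T = A -> eigenvalues_of A ev ->
  exists (P : 'M[R[i]]_n) (sp : 'I_n -> R),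
    [/\ P *m P^t* = 1%:M,
        map_mx (real_complex R) A
          = P^t* *m diag_mx (\row_i (sp i)%:C%C) *m P &
        perm_eq [seq sp i | i : 'I_n] ev].
Proof.
move=> symA [srt chA]; set f := real_complex R; set Ac := map_mx f A.
have conjf x : Num.conj (f x) = f x by apply/CrealP/complex_realP; exists x.
have herm : Ac \is hermsymmx.
  apply: realsym_hermsym.
    by apply/is_hermitianmxP; rewrite expr0 scale1r map_mx_id // map_trmx symA.
  by apply/mxOverP=> i j; rewrite mxE; apply/complex_realP; exists (A i j).
have /orthomx_spectralP := hermitian_normalmx herm.
have := hermitian_spectral_diag_real herm.
have := spectral_unitarymx Ac.
move: (spectralmx Ac) (spectral_diag Ac) => P d uP /mxOverP reald.
rewrite invmx_unitary // => AcE.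
have dE : d = \row_i (complex.Re (d 0 i))%:C%C.
  by apply/rowP=> i; rewrite mxE RRe_real // reald.
exists P, (fun i => complex.Re (d 0 i)); split.
- exact/unitarymxP.
- by rewrite AcE {1}dE.
apply: prod_XsubC_eq; rewrite -chA.
apply: (map_poly_inj f).
rewrite map_char_poly /= -/Ac AcE.
have PsP : P^t* *m P = 1%:M by apply/mulmx1C/unitarymxP.
rewrite char_poly_conj // char_poly_trig ?diag_mx_is_trig //.
rewrite rmorph_prod big_image /=; apply: eq_bigr => i _.
rewrite !mxE eqxx mulr1n rmorphB /= map_polyX map_polyC.
by rewrite [in RHS]dE mxE.
Qed.

(** If the eigenvalue were below [mu], fewer than [q] eigenvalues would be at
    least [mu]. The span of the rows of [V] over [R[i]], of dimension [q], would
    then contain a nonzero vector orthogonal to all their eigenvectors; the form at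
    that vector is less than [mu] times its squared norm. *)
Lemma eigenvalue_ge_of_form (R : realType) (n q : nat) (A : 'M[R]_n)
    (ev : n.-tuple R) (V : 'M[R]_(q, n)) (mu : R) :
    A^T = A -> eigenvalues_of A ev -> row_free V -> (0 < q)%N ->
    (forall y : 'rV[R]_q,
       mu * (y *m V *m (y *m V)^T) 0 0 <= (y *m V *m A *m (y *m V)^T) 0 0) ->
  mu <= ev`_(q - 1).
Proof.
move=> symA evA freeV q_gt0 formA; rewrite leNgt; apply/negP => ltmu.
set f := real_complex R.
have [P [sp [PPs AE spev]]] := spectral_decomposition symA evA.
have PsP : P^t* *m P = 1%:M by apply: mulmx1C.
pose J := [set i | mu <= sp i].
have leqn : (q <= n)%N by have := rank_leq_col V; rewrite (eqP freeV).
have cardJ : (#|J| < q)%N.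
  rewrite -[X in (_ < X)%N](subnKC q_gt0) add1n ltnS.
  have -> : #|J| = count (>= mu) ev.
    rewrite -(permP spev) count_map cardsE cardE /enum_mem !size_filter.
    by rewrite filter_predT; apply: eq_count => i; rewrite inE.
  apply: count_sorted_ge => //; first by case: evA.
  by rewrite size_tuple subn1 (leq_trans _ leqn) // prednK.
pose Vc := map_mx f V.
(* Column [j] of [M] lists the coordinates of the rows of [V] along the
   eigenvector of index [enum_val j]. *)
pose M := Vc *m P^t* *m colsub (fun j : 'I_#|J| => enum_val j) 1%:M.
have [y yker y0] : exists2 y : 'rV_q, (y <= kermx M)%MS & y != 0.
  apply/rowV0Pn; rewrite kermx_eq0 -row_leq_rank -ltnNge.
  exact: leq_ltn_trans (rank_leq_col M) cardJ.
pose a := y *m Vc *m P^t*.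
have aJ i : i \in J -> a 0 i = 0.
  move=> iJ; have /sub_kermxP /rowP/(_ (enum_rank_in iJ i)) := yker.
  rewrite /M !mulmxA -/a mulmx_colsub mulmx1 !mxE.
  by rewrite enum_rankK_in.
have a0 : a != 0.
  apply: contra y0 => /eqP a0; have : a *m P = 0 by rewrite a0 mul0mx.
  rewrite -mulmxA PsP mulmx1 => /eqP.
  by rewrite mulmx_free_eq0 // /row_free mxrank_map.
pose B := V *m (A - mu%:M) *m V^T.
have symB : B^T = B.
  by rewrite !trmx_mul trmxK linearB /= tr_scalar_mx symA mulmxA.
have posB (x : 'rV_q) : 0 <= (x *m B *m x^T) 0 0.
  have := formA x; rewrite -subr_ge0; congr (_ <= _).
  suff -> : x *m B *m x^T = x *m V *m A *m (x *m V)^T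
      - mu *: (x *m V *m (x *m V)^T).
    by rewrite [RHS]mxE [in X in _ = _ + X]mxE [in X in _ = _ - X]mxE.
  rewrite trmx_mul /B mulmxBr mul_mx_scalar mulmxBl mulmxBr mulmxBl.
  by rewrite -!(scalemxAl, scalemxAr) !mulmxA.
have := complexified_form_ge0 symB posB y.
suff -> : y *m map_mx f B *m y^t* =
    (\sum_i f (sp i - mu) * (`|a 0 i| ^+ 2))%:M.
  rewrite mxE eqxx mulr1n; apply/negP; rewrite lt_geF //.
  have [i ai] : exists i, a 0 i != 0.
    apply/existsP; apply: contraR a0 => /existsPn a0; apply/eqP/rowP => i.
    by rewrite [RHS]mxE; apply/eqP; rewrite -[_ == _]negbK.
  have term j : f (sp j - mu) * `|a 0 j| ^+ 2 <= 0.
    have [jJ|] := boolP (j \in J); first by rewrite aJ // normr0 expr0n mulr0.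
    rewrite inE -ltNge => ltj; rewrite mulr_le0_ge0 ?exprn_ge0 //.
    by rewrite -[0]/(f 0) lecR subr_le0 ltW.
  rewrite (bigD1 i) //= -[X in _ < X]addr0 ltr_leD //; last first.
    by apply: sumr_le0 => j _.
  rewrite nmulr_rlt0 ?exprn_gt0 ?normr_gt0 //.
  rewrite -[0]/(f 0) ltcR subr_lt0 ltNge.
  by apply: contra ai => imu; rewrite aJ ?inE.
pose D := diag_mx (\row_i f (sp i - mu)).
have DE : map_mx f (A - mu%:M) = P^t* *m D *m P.
  have -> : D = diag_mx (\row_i (sp i)%:C%C) - (f mu)%:M.
    apply/matrixP => j k; rewrite !mxE.
    case: eqP => _; rewrite ?mulr0n ?mulr1n ?subr0 //.
    exact: (rmorphB (real_complex R)).
  rewrite mulmxBr mulmxBl -AE mul_mx_scalar -scalemxAl PsP scalemx1.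
  by rewrite map_mxB map_scalar_mx.
have asE : a^t* = P *m (map_mx f V^T *m y^t*).
  rewrite /a !trmx_mul !map_mxM; apply: f_equal2; last apply: f_equal2.
    by apply/matrixP => j k; rewrite !mxE; exact: conjCK.
    by apply/matrixP => j k; rewrite !mxE; apply/CrealP/complex_realP;
       exists (V k j).
  by [].
have -> : y *m map_mx f B *m y^t* = a *m D *m a^t*.
  by rewrite asE /B !map_mxM DE /a !mulmxA.
apply/matrixP => j k; rewrite !ord1 [RHS]mxE eqxx mulr1n mxE.
apply: eq_bigr => i _; rewrite mul_mx_diag !mxE.
rewrite normCK mulrA; congr (_ * _). exact: mulrC.
Qed.

(** * Distances in a connected graph *)

Lemma gdist_le_path (T : finType) (e : rel T) (u v : T) (p : seq T) :
  path e u p -> last u p = v -> (gdist e u v <= size p)%N.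
Proof.
move=> pp; case: (shortenP pp) => p' pp' up' sub lastp; rewrite /gdist.
have szp' : (size p' < #|T|)%N.
  by rewrite -[_.+1]/(size (u :: p')) -(card_uniqP up') max_card.
apply: leq_trans (uniq_leq_size _ sub); last by case/andP: up'.
have wit : has_path_of_length e u v (size p').
  by apply/existsP; exists (in_tuple p'); rewrite pp' lastp eqxx.
rewrite leqNgt; apply/negP => /(before_find 0%N).
by rewrite nth_iota // add0n wit.
Qed.

Section ConnectedGraph.
Variables (T : finType) (e : rel T).
Hypothesis conn : connected_graph e.

Lemma gdist_path (u v : T) :
  exists p, [/\ path e u p, last u p = v & size p = gdist e u v].
Proof.
have : has (has_path_of_length e u v) (iota 0 #|T|).
  have /connectP[p pp lastp] := conn u v.
  move: lastp; case: (shortenP pp) => p' pp' up' _ lastp.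
  apply/hasP; exists (size p').
    rewrite mem_iota add0n /= -[_.+1]/(size (u :: p')) -(card_uniqP up').
    exact: max_card.
  by apply/existsP; exists (in_tuple p'); rewrite pp' lastp eqxx.
move=> hs; have := nth_find 0%N hs.
rewrite -/(gdist e u v) nth_iota; last first.
  by rewrite -[X in (_ < X)%N](size_iota 0) -has_find.
rewrite add0n => /existsP[p /and3P[pp /eqP lastp _]].
by exists p; rewrite size_tuple.
Qed.

Lemma gdist_triangle (u v w : T) :
  (gdist e u w <= gdist e u v + gdist e v w)%N.
Proof.
have [p [pp lp <-]] := gdist_path u v; have [q [pq lq <-]] := gdist_path v w.
rewrite -size_cat; apply: gdist_le_path; first by rewrite cat_path pp lp.
by rewrite last_cat lp.
Qed.

Lemma gdist_sym (sym : symmetric e) (u v : T) : gdist e u v = gdist e v u.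
Proof.
suff le x y : (gdist e x y <= gdist e y x)%N by apply/eqP; rewrite eqn_leq !le.
have [p [pp lp <-]] := gdist_path y x.
rewrite -(size_belast y p) -size_rev; apply: gdist_le_path.
  by rewrite -lp rev_path (eq_path (e' := e)) // => a b; rewrite sym.
case: p pp lp => [|a p] //= _ _; by rewrite rev_cons last_rcons.
Qed.

(** A shortest path between vertices at distance the diameter is isometric: a
    shortcut inside it would shorten the whole path. *)
Lemma isometric_diametral_path (sym : symmetric e) (u v : T) :
  exists p : nat -> T,
    forall i j, (i <= gdist e u v)%N -> (j <= gdist e u v)%N ->
      gdist e (p i) (p j) = (i - j + (j - i))%N.
Proof.
have [q [pq lq szq]] := gdist_path u v.
pose p i := nth u (u :: q) i; exists p.
suff le i j : (i <= j)%N -> (j <= gdist e u v)%N ->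
    gdist e (p i) (p j) = (j - i)%N.
  move=> i j lei lej; case/orP: (leq_total i j) => leij.
    by rewrite le // (eqP leij).
  by rewrite gdist_sym // le // (eqP leij) addn0.
move=> leij lej.
have up a b : (a <= b)%N -> (b <= gdist e u v)%N ->
    (gdist e (p a) (p b) <= b - a)%N.
  move=> leab leb.
  have -> : (b - a)%N = size (take (b - a) (drop a q)).
    by rewrite size_takel // size_drop szq leq_sub2r.
  have lasta c : (c <= gdist e u v)%N -> last u (take c q) = p c.
    case: c => [|c] ltc; first by rewrite take0.
    by rewrite (last_nth u) size_takel ?szq // /p /= nth_take.
  apply: gdist_le_path.
    have := pq; rewrite -{1}(cat_take_drop a q) cat_path => /andP[_].
    rewrite -{1}(cat_take_drop (b - a) (drop a q)) cat_path => /andP[+ _].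
    by rewrite lasta // (leq_trans leab).
  rewrite -(lasta b leb) -[in RHS](subnKC leab) takeD last_cat.
  by rewrite lasta // (leq_trans leab).
apply/eqP; rewrite eqn_leq up //=.
have := gdist_triangle u (p i) v; have := gdist_triangle (p i) (p j) v.
have := up 0%N i (leq0n _) (leq_trans leij lej).
have := up j _ lej (leqnn _).
have -> : p (gdist e u v) = v by rewrite /p -szq -last_nth.
rewrite -[p 0%N]/u; lia.
Qed.

End ConnectedGraph.

Lemma diameter_attained (T : finType) (e : rel T) (x0 : T) :
  exists u v, gdist e u v = diameter e.
Proof.
have T0 : (0 < #|T|)%N by apply/card_gt0P; exists x0.
have [u uE] : {u : T | diameter e = \max_(v : T) gdist e u v}.
  exact: bigop.eq_bigmax.
have [v vE] : {v : T | \max_(v : T) gdist e u v = gdist e u v}.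
  exact: bigop.eq_bigmax.
by exists u, v; rewrite uE vE.
Qed.

(** The triangle inequality through every vertex shows that the transmissions of
    the ends of a diametral pair add up to at least [#|T| * diameter e]. The
    inequality is strict because the remoteness divides by [#|T| - 1] only. *)
Lemma remoteness_gt_half_diameter (R : realType) (T : finType) (e : rel T) :
    symmetric e -> connected_graph e -> (1 < #|T|)%N -> (0 < diameter e)%N ->
  (diameter e)%:R / 2 < remoteness R e.
Proof.
move=> sym conn card1 d0.
have [x0 _] : exists x0, x0 \in T by apply/card_gt0P; apply: ltnW.
have [u [v uvE]] := diameter_attained e x0.
have tr_le w : (transmission e w)%:R / (#|T| - 1)%:R <= remoteness R e.
  by apply: (le_bigmax _ (fun w => (transmission e w)%:R / (#|T| - 1)%:R)).
have sum_le : (#|T| * diameter e <= transmission e u + transmission e v)%N.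
  rewrite -big_split /= -sum_nat_const; apply: leq_sum => w _.
  by rewrite -uvE (leq_trans (gdist_triangle conn u w v)) // (gdist_sym conn sym u).
have n1 : 0 < (#|T| - 1)%:R :> R by rewrite ltr0n subn_gt0.
have := tr_le u; have := tr_le v; rewrite !ler_pdivrMr // => lev leu.
have : (#|T|)%:R * (diameter e)%:R <= (2 * remoteness R e) * (#|T| - 1)%:R.
  rewrite -natrM (le_trans (y := (transmission e u + transmission e v)%:R)) //.
    by rewrite ler_nat.
  by rewrite natrD -mulrA mulr_natl mulr2n lerD.
rewrite ltr_pdivrMr // [_ * 2]mulrC -(ltr_pM2r n1); apply: lt_le_trans.
by rewrite mulrC ltr_pM2r ?ltr0n // ltr_nat subn1 ltn_predL ltnW.
Qed.

(** * The distance form of a path in terms of cuts *)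

Section CutSums.
Variable R : realFieldType.

Definition cut_sign (t i : nat) : R := if (i < t)%N then 1 else -1.

(** The cut at [t = 0] is trivial: [cut_sum y 0] is minus the sum of the entries.
    Including it makes every entry of [y] half of a difference of consecutive
    cut sums. *)
Definition cut_sum (n : nat) (y : 'rV[R]_n) (t : nat) : R :=
  \sum_(i < n) cut_sign t i * y 0 i.

(** Exactly [|i - j|] of the cuts [{k < t}, {k >= t}] separate [i] from [j], and
    the summand is 2 for these and 0 for the others. *)
Lemma path_dist_cut_sign (n i j : nat) : (i < n)%N -> (j < n)%N ->
  (i - j + (j - i))%:R * 2
    = \sum_(1 <= t < n) (1 - cut_sign t i * cut_sign t j).
Proof.
wlog leij : i j / (i <= j)%N => [th|] lti ltj.
  case/orP: (leq_total i j) => le; first exact: th.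
  rewrite addnC th //; apply: eq_bigr => t _.
  by rewrite [cut_sign t i * _]mulrC.
rewrite (@big_cat_nat _ _ _ i.+1) //= [X in _ + X](@big_cat_nat _ _ _ j.+1) //=.
have sgn t k : cut_sign t k = if (t <= k)%N then -1 else 1.
  by rewrite /cut_sign ltnNge; case: leqP.
have -> : \sum_(1 <= t < i.+1) (1 - cut_sign t i * cut_sign t j) = 0.
  apply: big1_seq => t; rewrite mem_index_iota ltnS => /andP[_ /andP[_ lt]].
  by rewrite !sgn lt (leq_trans lt leij); ring.
have -> : \sum_(j.+1 <= t < n) (1 - cut_sign t i * cut_sign t j) = 0.
  apply: big1_seq => t; rewrite mem_index_iota => /andP[_ /andP[lt _]].
  by rewrite /cut_sign lt (leq_ltn_trans leij lt); ring.
rewrite (eqP leij) add0n add0r addr0 big_nat (eq_bigr (fun=> 2)); last first.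
  by move=> t /andP[lt1 lt2]; rewrite {1}/cut_sign lt1 sgn -ltnS lt2 /=; ring.
by rewrite -big_nat sumr_const_nat subSS mulr_natl.
Qed.

Variables (d : nat) (y : 'rV[R]_d.+1).

Lemma cut_sum_last : cut_sum y d.+1 = - cut_sum y 0.
Proof.
rewrite /cut_sum -sumrN; apply: eq_bigr => i _.
by rewrite /cut_sign ltn_ord ltn0 mulN1r opprK mul1r.
Qed.

Lemma cut_sum_step (i : 'I_d.+1) : cut_sum y i.+1 - cut_sum y i = 2 * y 0 i.
Proof.
rewrite /cut_sum -sumrB (bigD1 i) //= big1 ?addr0 => [|j ji].
  by rewrite /cut_sign ltnSn ltnn; ring.
rewrite /cut_sign ltnS leq_eqVlt -[(j == i :> nat)]/(j == i) (negPf ji) /=.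
by rewrite subrr.
Qed.

Lemma path_form_cut_sum :
  \sum_(i < d.+1) \sum_(j < d.+1) (i - j + (j - i))%:R * (y 0 i * y 0 j)
    = (d%:R * cut_sum y 0 ^+ 2 - \sum_(1 <= t < d.+1) cut_sum y t ^+ 2) / 2.
Proof.
have sqE t : \sum_(i < d.+1) \sum_(j < d.+1)
    (cut_sign t i * cut_sign t j) * (y 0 i * y 0 j) = cut_sum y t ^+ 2.
  rewrite expr2 {1}/cut_sum mulr_suml; apply: eq_bigr => i _.
  by rewrite /cut_sum mulr_sumr; apply: eq_bigr => j _; ring.
apply: (mulIf (x := 2)); first by rewrite pnatr_eq0.
rewrite divfK ?pnatr_eq0 //.
have -> : d%:R * cut_sum y 0 ^+ 2 = \sum_(1 <= t < d.+1) cut_sum y 0 ^+ 2.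
  by rewrite sumr_const_nat subn1 mulr_natl.
rewrite -sumrB.
under [RHS]eq_bigr => t _.
  rewrite -!sqE -sumrB.
  under eq_bigr => i _.
    rewrite -sumrB.
    under eq_bigr => j _ do rewrite -mulrBl.
    over.
  over.
rewrite [RHS]exchange_big mulr_suml /=; apply: eq_bigr => i _.
rewrite [RHS]exchange_big mulr_suml /=; apply: eq_bigr => j _.
rewrite mulrAC (path_dist_cut_sign (n := d.+1)) // mulr_suml.
by apply: eq_bigr => t _; rewrite /cut_sign !ltn0; ring.
Qed.

End CutSums.

(** * A Poincare inequality from weights *)

(** With [d * W_0 ^ 2] on its side, position [0] of the cycle only needs
    [w 1 + w d <= 6 * w 0]. At the other positions where [w] is positive, [w] is
    a supersolution of the discrete Laplacian for the eigenvalue [4 / d], that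
    is [w (i - 1) + w (i + 1) <= (2 - 4 / d) * w i]. *)
Definition admissible_weight (d : nat) (w : nat -> nat) : bool :=
  [&& w d.+1 == w 0%N, (0 < w 0)%N ==> (w 1 + w d <= 6 * w 0)%N &
      all (fun i => (0 < w i)%N ==>
             (d * (w i.-1 + w i.+1) + 4 * w i <= 2 * d * w i)%N) (iota 1 d)].

Definition weight_zeros (d : nat) (w : nat -> nat) : seq nat :=
  [seq i <- iota 0 d.+1 | w i == 0%N].

(** For positive weights the difference of the two sides is
    [(b * v - a * w) ^ 2 / (v * w)]. For a zero weight the convention [x / 0 = 0]
    leaves an equality. *)
Lemma weighted_diff_sqr (R : realFieldType) (a b : R) (v w : nat) :
    (v = 0%N -> a = 0) -> (w = 0%N -> b = 0) ->
  b ^+ 2 * (1 - v%:R / w%:R) + a ^+ 2 * (1 - w%:R / v%:R) <= (b - a) ^+ 2.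
Proof.
case: v => [|v] va; first by rewrite va // expr0n mul0r !mul0r !subr0 mulr1 addr0.
case: w => [|w] wb; first by rewrite wb // expr0n !mul0r sub0r subr0 mulr1
  add0r sqrrN.
have := ltr0Sn R v; have := ltr0Sn R w.
move: (v.+1%:R) (w.+1%:R) => p q q0 p0.
rewrite -subr_ge0.
have -> : (b - a) ^+ 2 - (b ^+ 2 * (1 - p / q) + a ^+ 2 * (1 - q / p))
    = (b * p - a * q) ^+ 2 / (p * q).
  by field; rewrite (gt_eqF p0) (gt_eqF q0).
by rewrite divr_ge0 ?sqr_ge0 // ltW // mulr_gt0.
Qed.

(** Summing [weighted_diff_sqr] over consecutive cut sums bounds the sum of the
    [(W_(i+1) - W_i) ^ 2] below by a diagonal form in [W], whose coefficients are
    those that admissibility controls. The ends [0] and [d + 1] are collected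
    into one position because [W_(d+1) = - W_0]. *)
Lemma path_form_ge (R : realFieldType) (d : nat) (w : nat -> nat)
    (y : 'rV[R]_d.+1) :
    (0 < d)%N -> admissible_weight d w ->
    (forall t, t \in weight_zeros d w -> cut_sum y t = 0) ->
  - (d%:R / 2) * \sum_(i < d.+1) y 0 i ^+ 2 <=
    \sum_(i < d.+1) \sum_(j < d.+1) (i - j + (j - i))%:R * (y 0 i * y 0 j).
Proof.
move=> d0 /and3P[/eqP wd w01 /allP wi] y0.
set W := cut_sum y.
have W0 t : (t <= d.+1)%N -> w t = 0%N -> W t = 0.
  have W0' s : (s < d.+1)%N -> w s = 0%N -> W s = 0.
    by move=> lts ws; apply: y0; rewrite mem_filter ws mem_iota /= add0n.
  rewrite leq_eqVlt => /orP[/eqP ->|]; last exact: W0'.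
  by rewrite wd => /W0' h; rewrite /W cut_sum_last -/W h ?oppr0.
rewrite path_form_cut_sum -/W.
have dR : 0 < d%:R :> R by rewrite ltr0n.
pose c i j : R := W i ^+ 2 * (1 - (w j)%:R / (w i)%:R).
have step (i : 'I_d.+1) : c i.+1 i + c i i.+1 <= 4 * y 0 i ^+ 2.
  have -> : 4 * y 0 i ^+ 2 = (W i.+1 - W i) ^+ 2.
    by rewrite cut_sum_step exprMn; congr (_ * _); ring.
  by apply: weighted_diff_sqr; apply: W0 => //; apply: ltnW.
have total : \sum_(i < d.+1) (c i.+1 i + c i i.+1)
    <= 4 * \sum_(i < d.+1) y 0 i ^+ 2.
  by rewrite mulr_sumr; apply: ler_sum => i _; apply: step.
have inner t : (1 <= t < d.+1)%N ->
    4 * W t ^+ 2 <= d%:R * (c t t.-1 + c t t.+1).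
  move=> /andP[t1 td]; have [wt0|wt0] := posnP (w t).
    by rewrite /c (W0 t (ltnW td) wt0) expr0n !mul0r addr0 !mulr0.
  have := wi t; rewrite mem_iota t1 add1n td wt0 => /(_ isT).
  rewrite implyTb -(ler_nat R) natrD !natrM natrD => ineq.
  have wt0R : 0 < (w t)%:R :> R by rewrite ltr0n.
  rewrite /c -mulrDr [leRHS]mulrCA [leLHS]mulrC; apply: ler_wpM2l.
    exact: sqr_ge0.
  rewrite -(ler_pM2r wt0R).
  have -> : d%:R * (1 - (w t.-1)%:R / (w t)%:R + (1 - (w t.+1)%:R / (w t)%:R))
     * (w t)%:R = 2 * d%:R * (w t)%:R - d%:R * ((w t.-1)%:R + (w t.+1)%:R) :> R.
    by field; rewrite gt_eqF.
  by rewrite lerBrDl.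
have ends : - 4 * W 0%N ^+ 2 <= c d.+1 d + c 0%N 1%N.
  have [w00|w00] := posnP (w 0%N).
    by rewrite /c !W0 ?wd // expr0n !mul0r addr0 mulr0.
  move: w01; rewrite w00 implyTb -(ler_nat R) natrM natrD => ineq.
  have w0R : 0 < (w 0%N)%:R :> R by rewrite ltr0n.
  rewrite /c wd [W d.+1]cut_sum_last sqrrN -/W -mulrDr [leLHS]mulrC.
  apply: ler_wpM2l; first exact: sqr_ge0.
  rewrite -(ler_pM2r w0R).
  have -> : (1 - (w d)%:R / (w 0%N)%:R + (1 - (w 1%N)%:R / (w 0%N)%:R))
     * (w 0%N)%:R = 2 * (w 0%N)%:R - ((w 1%N)%:R + (w d)%:R) :> R.
    by field; rewrite gt_eqF.
  by clear -ineq; lra.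
have regroup : \sum_(i < d.+1) (c i.+1 i + c i i.+1)
    = c d.+1 d + c 0%N 1%N + \sum_(1 <= t < d.+1) (c t t.-1 + c t t.+1).
  rewrite big_split /= big_ord_recr [X in _ + X]big_ord_recl /=.
  rewrite big_split /= !big_add1 /= !big_mkord.
  ring.
have inner_sum : 4 * \sum_(1 <= t < d.+1) W t ^+ 2
    <= d%:R * \sum_(1 <= t < d.+1) (c t t.-1 + c t t.+1).
  by rewrite !mulr_sumr big_nat [leRHS]big_nat ler_sum.
move: total; rewrite regroup.
have := ler_wpM2l (ltW dR) ends.
move=> e1 /(ler_wpM2l (ltW dR)) e2.
move: e1 e2 inner_sum; move: (\sum_(1 <= t < _) _ ^+ 2) (\sum_(_ <= _ < _) _).
move: (\sum_(_ < _) _) (c d.+1 d) (c 0%N 1%N) (W 0%N ^+ 2) (d%:R : R).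
move=> Y c1 c2 W02 D S1 S2; clear; rewrite !mulrDr => e1 e2 e3; lra.
Qed.

(** * Weights with few zeros *)

(** The arc [x * (g - x)] has second difference -2, so it is a supersolution for
    [4 / d] as soon as twice its maximum is at most [d]. The maximum is at most
    [g ^ 2 / 4], and integrality allows [g * g <= 2 * d + 1]. *)
Lemma periodic_weight (d g : nat) : (0 < g)%N -> (g * g <= 2 * d + 1)%N ->
    (d %/ g + (7 * d) %/ 8 <= d)%N ->
  exists w, admissible_weight d w /\
    (size (weight_zeros d w) + (7 * d) %/ 8 <= d.+1)%N.
Proof.
move=> g0 gd dg.
(* The last arc is cut short: setting [w d.+1] to 0 only lowers a neighbour. *)
pose w i := if (i <= d)%N then ((i %% g) * (g - i %% g))%N else 0%N.
have wmod q r : (r < g)%N -> (w (q * g + r) <= r * (g - r))%N.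
  by move=> rg; rewrite /w; case: ifP => // _; rewrite modnMDl modn_small.
exists w; split.
  apply/and3P; split; first by rewrite /w ltnn mod0n mul0n.
    by rewrite /w mod0n.
  apply/allP => i; rewrite mem_iota add1n ltnS => /andP[_ id].
  have wi : w i = ((i %% g) * (g - i %% g))%N by rewrite /w id.
  apply/implyP; rewrite wi muln_gt0 => /andP[r0 _].
  have iE := divn_eq i g; have rg := ltn_pmod i g0.
  move: r0 iE rg; move: (i %/ g)%N (i %% g)%N => q [|r] // _ iE rg.
  have le1 : (w i.-1 <= r * (g - r))%N.
    by rewrite iE addnS /=; apply: wmod; apply: ltnW.
  have le2 : (w i.+1 <= r.+2 * (g - r.+2))%N.
    rewrite iE -addnS; move: rg; rewrite leq_eqVlt => /orP[/eqP gE|].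
      by rewrite gE -mulSnr -[(_ * _)%N]addn0 (leq_trans (wmod _ _ _)).
    exact: wmod.
  pose h := (g - r.+2)%N.
  have e1 : (g - r = h.+2)%N by rewrite /h; lia.
  have e2 : (g - r.+1 = h.+1)%N by rewrite /h; lia.
  have e3 : g = (r.+1 + h.+1)%N by rewrite /h; lia.
  rewrite e2; rewrite e1 in le1; rewrite -/h in le2; rewrite e3 in gd.
  have conc : (w i.-1 + w i.+1 + 2 <= 2 * (r.+1 * h.+1))%N by clear -le1 le2; lia.
  have small : (2 * (r.+1 * h.+1) <= d)%N.
    have agm := leq_trans (nat_AGM2 r.+1 h.+1) gd; move: agm; clear.
    by move: (r.+1 * h.+1)%N => m; lia.
  have := leq_mul (leqnn d) conc; rewrite mulnDr => dconc.
  clear -dconc small; lia.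
apply: leq_trans (_ : (d %/ g).+1 + (7 * d) %/ 8 <= _)%N; last first.
  by rewrite addSn ltnS.
rewrite leq_add2r size_filter -sum1_count.
have -> : iota 0 d.+1 = index_iota 0 d.+1 by rewrite /index_iota subn0.
rewrite big_mkcond big_nat_recl // /= divn_count_dvd big_add1 /=.
rewrite -[X in (_ <= X)%N]add1n leq_add //; first by case: ifP.
rewrite big_nat [leqRHS]big_nat; apply: leq_sum => i /andP[_ id].
rewrite /w id muln_eq0 subn_eq0 [(g <= _)%N]leqNgt ltn_pmod // orbF /dvdn.
by case: eqP.
Qed.

Lemma list_weight (d : nat) (s : seq nat) :
    admissible_weight d (nth 0%N s) ->
    (count (fun i => nth 0 s i == 0) (iota 0 d.+1) + (7 * d) %/ 8 <= d.+1)%N ->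
  exists w, admissible_weight d w /\
    (size (weight_zeros d w) + (7 * d) %/ 8 <= d.+1)%N.
Proof.
by move=> adm cnt; exists (nth 0%N s); rewrite /weight_zeros size_filter.
Qed.

(** Rounding up [d / 8] leaves room for one zero more than that. In the listed
    weights the first and the last entry are both the weight of position [0],
    which is positive there. Their entries are small integers for which the
    inequalities can be verified by evaluation. *)
Lemma exists_weight (d : nat) : (2 <= d)%N ->
  exists w, admissible_weight d w /\
    (size (weight_zeros d w) + (7 * d) %/ 8 <= d.+1)%N.
Proof.
move=> d2; case: (leqP 32 d) => [d32|d32].
  by apply: (@periodic_weight d 8) => //; lia.
have [d6|n6] := eqVneq d 6%N.
  by rewrite d6; apply: (list_weight (s := [:: 1; 1; 0; 1; 1; 0; 1; 1])%N).
have [d7|n7] := eqVneq d 7%N.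
  by rewrite d7; apply: (list_weight (s := [:: 1; 3; 3; 0; 1; 1; 0; 1; 1])%N).
have [d8|n8] := eqVneq d 8%N.
  by rewrite d8;
     apply: (list_weight (s := [:: 1; 3; 2; 0; 1; 1; 0; 2; 3; 1])%N).
have [d15|n15] := eqVneq d 15%N.
  rewrite d15; apply: (list_weight
    (s := [:: 1; 3; 2; 0; 2; 3; 3; 2; 0; 2; 3; 3; 2; 0; 2; 3; 1])%N) => //.
have [d16|n16] := eqVneq d 16%N.
  rewrite d16; apply: (list_weight
    (s := [:: 1; 3; 2; 0; 2; 3; 3; 2; 0; 2; 3; 3; 2; 0; 3; 4; 3; 1])%N) => //.
(* For every other [d < 32] one arc length from 2 to 7 is suitable. *)
pose fits g := (g * g <= 2 * d + 1)%N && (d %/ g + (7 * d) %/ 8 <= d)%N.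
suff : has fits (iota 2 6).
  case/hasP => g; rewrite mem_iota => /andP[g2 _] /andP[gd dg].
  by apply: periodic_weight gd dg; apply: ltnW.
rewrite /fits; clear fits; move: n16 n15 n8 n7 n6 d2 d32.
by do 32?[case: d => [|d] //].
Qed.

(** * The eigenvalue bound *)

Theorem mainTheorem2 (R : realType) (T : finType) (e : rel T)
    (ev : #|T|.-tuple R)
    (simple_e : simple_graph e) (connected_e : connected_graph e)
    (order_ge4 : (4 <= #|T|)%N) (diameter_ge2 : (2 <= diameter e)%N)
    (ev_spectrum : distance_eigenvalues e ev) :
  remoteness R e + ev`_((7 * diameter e) %/ 8 - 1)%N > 0.
Proof.
have [sym _] := simple_e; set d := diameter e in diameter_ge2 *.
set k := (7 * d %/ 8)%N.
have d0 : (0 < d)%N by apply: ltnW.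
have rho : d%:R / 2 < remoteness R e.
  by apply: remoteness_gt_half_diameter => //; apply: leq_trans order_ge4.
suff evk : - (d%:R / 2) <= ev`_(k - 1).
  by rewrite -ltrBlDr sub0r (le_lt_trans _ rho) // lerNl.
have [w [adm fewz]] := exists_weight diameter_ge2.
have [x0 _] : exists x0, x0 \in T.
  by apply/card_gt0P; apply: leq_trans order_ge4.
have [u [v uvE]] := diameter_attained e x0; rewrite -/d in uvE.
have [p isop] := isometric_diametral_path connected_e sym u v.
rewrite uvE in isop.
have distp (i j : 'I_d.+1) : gdist e (p i) (p j) = (i - j + (j - i))%N.
  by apply: isop; rewrite -ltnS.
pose D := distance_matrix R e.
pose rk (i : 'I_d.+1) := enum_rank (p i).
(* The rows of [E] are the indicator vectors of the path vertices. *)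
pose E : 'M[R]_(d.+1, #|T|) := rowsub rk 1%:M.
have rk_inj : injective rk.
  move=> i j /enum_rank_inj pij; apply/val_inj/eqP => /=.
  have := distp i j; rewrite pij distp subnn => /esym/eqP.
  by rewrite addn_eq0 !subn_eq0 eqn_leq.
have mulE m (M : 'M[R]_(#|T|, m)) : E *m M = rowsub rk M.
  by rewrite mul_rowsub_mx mul1mx.
have EE : E *m E^T = 1%:M.
  by apply/matrixP => i j; rewrite mulE !mxE eq_sym (inj_eq rk_inj).
have EDE : E *m D *m E^T = \matrix_(i, j) (i - j + (j - i))%:R.
  apply/matrixP => i j; rewrite mulE mxE (bigD1 (rk j)) //= big1 => [|l lj].
    by rewrite !mxE eqxx mulr1 addr0 !enum_rankK distp.
  by rewrite !mxE eq_sym (negPf lj) mulr0.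
have symD : D^T = D.
  by apply/matrixP => i j; rewrite !mxE (gdist_sym connected_e sym).
pose Z := weight_zeros d w.
(* Row vectors in [K] have zero cut sum at every zero of the weight. *)
pose K := kermx (\matrix_(i < d.+1, j < size Z) cut_sign R (nth 0%N Z j) i).
pose V := row_base K *m E.
have freeE : row_free E by apply/row_freeP; exists E^T.
have freeV : row_free V.
  by rewrite /row_free mxrankMfree // -/(row_free _) row_base_free.
have kK : (k <= \rank K)%N.
  rewrite mxrank_ker leq_subRL; last exact: rank_leq_row.
  by rewrite (leq_trans _ fewz) // leq_add2r rank_leq_col.
have k1 : (0 < k)%N by rewrite divn_gt0 // (@leq_trans (7 * 2)) // leq_mul2l.
(* The kernel may be larger than needed, which gives a bound on a later
   eigenvalue. *)
apply: (le_trans (y := ev`_(\rank K - 1))); last first.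
  have [srt _] := ev_spectrum.
  have leqn := rank_leq_col V; rewrite (eqP freeV) in leqn.
  have ltn : (\rank K - 1 < #|T|)%N.
    by rewrite subn1 prednK ?(leq_trans k1).
  apply: (sorted_leq_nth _ _ 0 srt).
  - by move=> a b c /[swap]; apply: le_trans.
  - exact: lexx.
  - by rewrite inE size_tuple (leq_ltn_trans _ ltn) // leq_sub2r.
  - by rewrite inE size_tuple.
  - by rewrite leq_sub2r.
apply: (eigenvalue_ge_of_form symD ev_spectrum freeV) => [|x].
  exact: leq_trans kK.
pose y := x *m row_base K.
have yK : (y <= K)%MS by rewrite (submx_trans (submxMl _ _)) // eq_row_base.
have cut0 t : t \in weight_zeros d w -> cut_sum y t = 0.
  rewrite -/Z => tZ.
  have tlt : (index t Z < size Z)%N by rewrite index_mem.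
  have /sub_kermxP/rowP/(_ (Ordinal tlt)) := yK.
  rewrite [LHS]mxE [RHS]mxE /= => <-; apply: eq_bigr => i _.
  by rewrite [in RHS]mxE nth_index // mulrC.
have -> : x *m V = y *m E by rewrite /y mulmxA.
have -> : y *m E *m (y *m E)^T = y *m y^T.
  by rewrite trmx_mul mulmxA -[y *m E *m _]mulmxA EE mulmx1.
have -> : y *m E *m D *m (y *m E)^T = y *m (E *m D *m E^T) *m y^T.
  by rewrite trmx_mul !mulmxA.
rewrite EDE.
have := path_form_ge d0 adm cut0.
have -> : (y *m y^T) 0 0 = \sum_(i < d.+1) y 0 i ^+ 2.
  by rewrite mxE; apply: eq_bigr => i _; rewrite [y^T _ _]mxE.
suff -> : (y *m \matrix_(i, j) (i - j + (j - i))%:R *m y^T) 0 0 =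
  \sum_(i < d.+1) \sum_(j < d.+1) (i - j + (j - i))%:R * (y 0 i * y 0 j) by [].
rewrite exchange_big mxE; apply: eq_bigr => j _.
rewrite mxE mulr_suml; apply: eq_bigr => i _.
by rewrite [y^T _ _]mxE [X in _ * X * _]mxE mulrAC mulrC.
Qed.
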